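(* Let $F:\mathbb R\to\mathbb R$ be a non-decreasing function with $F(\tau)=\frac12[F(\tau+0)+F(\tau-0)]$ for all $\tau\in\mathbb R$. Let $\rho:\mathbb R\to\mathbb R$ be a continuous function such that $|\rho(\tau)|\le \mathrm{const}\,(1+\tau^2)^{-m-1}$ for some $m>0$, $\int_{\mathbb R}\rho(\tau)\,d\tau=1$, $\rho$ is even, and $\rho\ge0$. Assume that for some $\delta>0$ and some $\tau\in\mathbb R$ one has $\rho_{\delta,0}(\tau-s)\,F(s)\to0$ as $s\to+\infty$ and as $s\to-\infty$, and $\rho_{\delta,0}*F'(\tau)<\infty$. Then for all $T\ge\delta$ the convolution $\rho_T*F(\tau)$ is well defined and finite, and $$|F(\tau)-\rho_T*F(\tau)|\ \le\ c_{\rho,1}^{-1}\,\delta^{-1}\,\rho_{\delta,0}*F'(\tau).$$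
   Context: Notation: $\rho_T(\tau):=T\rho(T\tau)$; $\rho_{\delta,0}(\tau):=\delta\,\rho_{1,0}(\delta\tau)$, where $\rho_{1,0}(\tau):=\int_\tau^\infty\mu\,\rho(\mu)\,d\mu$; $c_{\rho,1}:=\int_{\mathbb R}|\mu|\,\rho(\mu)\,d\mu$. For a piecewise continuous function $f$ on $\mathbb R$, $f*F(\tau):=\lim_{R\to\infty}\int_{-R}^R f(\tau-\mu)F(\mu)\,d\mu$ and $f*F'(\tau):=\lim_{R\to\infty}\int_{(-R,R)}f(\tau-\mu)\,dF(\mu)$ (Lebesgue–Stieltjes integral), whenever the limits exist. *)

(* Defs.v *)
From HB Require Import structures.
From mathcomp Require Import all_boot all_order all_algebra.
From mathcomp Require Import all_classical all_reals all_analysis.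

Set Implicit Arguments.
Unset Strict Implicit.
Unset Printing Implicit Defensive.
Import Order.TTheory GRing.Theory Num.Theory.
Import numFieldNormedType.Exports.

Local Open Scope classical_set_scope.
Local Open Scope ring_scope.

Definition right_limit (R : realType) (F : R -> R) (x : R) : R :=
  lim (F y @[y --> x^'+]).

Definition left_limit (R : realType) (F : R -> R) (x : R) : R :=
  lim (F y @[y --> x^'-]).

Section stieltjes.
Context (R : realType) (F : R -> R) (ndF : {homo F : x y / x <= y}).

Lemma cvg_right_limit x : F y @[y --> x^'+] --> right_limit F x.
Proof.
apply: nondecreasing_at_right_is_cvgr; near=> e.
  by move=> y z _ _; exact: ndF.
exists (F x) => _ [y /=] + <-; rewrite in_itv/= => /andP[xy _].
exact/ndF/ltW.
Unshelve. all: by end_near. Qed.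

Lemma ge_right_limit x y : x < y -> right_limit F x <= F y.
Proof.
move=> xy; apply: limr_le; first exact: (cvgP _ (@cvg_right_limit x)).
near=> z; apply/ndF/ltW; near: z; exact: nbhs_right_lt.
Unshelve. all: by end_near. Qed.

Lemma le_right_limit x : F x <= right_limit F x.
Proof.
apply: limr_ge; first exact: (cvgP _ (@cvg_right_limit x)).
near=> z; apply/ndF/ltW; near: z; exact: nbhs_right_gt.
Unshelve. all: by end_near. Qed.

Lemma right_limit_nondecreasing : {homo right_limit F : x y / x <= y}.
Proof.
move=> x y; rewrite le_eqVlt => /predU1P[->//|xy].
exact: le_trans (ge_right_limit xy) (le_right_limit y).
Qed.

Lemma right_limit_right_continuous : right_continuous (right_limit F).
Proof.
move=> x; apply/cvgrPdist_le => e e0.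
have /cvgrPdist_le/(_ e e0)[d /= d0 Hd] := @cvg_right_limit x.
near=> y.
have xy : x < y by near: y; exact: nbhs_right_gt.
have yd : y < x + d / 2.
  by near: y; apply: nbhs_right_lt; rewrite ltrDl divr_gt0.
have xz : x < x + d / 2 by exact: lt_trans yd.
have /Hd /(_ xz) : ball_ Num.norm x d (x + d / 2).
  rewrite /ball_ /= opprD addrA subrr add0r normrN gtr0_norm ?divr_gt0//.
  by rewrite ltr_pdivrMr// ltr_pMr// ltr1n.
rewrite distrC ger0_norm ?subr_ge0 ?ge_right_limit// => Hz.
rewrite distrC ger0_norm ?subr_ge0; last exact/right_limit_nondecreasing/ltW.
by apply: le_trans Hz; rewrite lerD2r ge_right_limit.
Unshelve. all: by end_near. Qed.

(* The measure dF of a non-decreasing F depends only on its one-sided limits: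
   dF `]a, b] = F (b + 0) - F (a + 0).  As lebesgue_stieltjes_measure expects a
   right-continuous function, F is replaced by x |-> F (x + 0). *)
Definition stieltjes_cumulative : cumulative R R :=
  HB.pack (right_limit F)
    (@isCumulative.Build R _ R (right_limit F)
       right_limit_nondecreasing right_limit_right_continuous).

Definition stieltjes := lebesgue_stieltjes_measure stieltjes_cumulative.

End stieltjes.

Section convolution.
Context (R : realType).

Definition convolution_trunc (f F : R -> R) (t r : R) : \bar R :=
  (\int[lebesgue_measure]_(x in `[(- r)%R, r]) (f (t - x) * F x)%R%:E)%E.

(* lim is total, so the existence of the limit must be stated separately; for
   convolution_stieltjes below it is automatic when f is continuous and
   nonnegative, since the truncated integrals are then nondecreasing in r. *)
Definition convolution (f F : R -> R) (t : R) : \bar R :=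
  lim (convolution_trunc f F t r @[r --> +oo]).

Definition convolution_stieltjes (f F : R -> R) (ndF : {homo F : x y / x <= y})
    (t : R) : \bar R :=
  lim ((\int[stieltjes ndF]_(x in `](- r)%R, r[) (f (t - x)%R)%:E)%E
    @[r --> +oo]).

(* For rho and T this is rho_T; for rho10 rho and delta it is rho_{delta,0}. *)
Definition rescale (a : R) (f : R -> R) (t : R) : R := a * f (a * t).

Definition rho10 (rho : R -> R) (t : R) : R :=
  \int[lebesgue_measure]_(x in `[t, +oo[) (x * rho x).

Definition abs_moment1 (rho : R -> R) : R :=
  \int[lebesgue_measure]_x (`|x| * rho x).

End convolution.

(* Main.v *)
(* After the substitution y = T (t - x) and averaging over y |-> - y, the weighted
   oscillation of F about t is at most half the integral against rho of
   dF [t - |y|/T, t + |y|/T].  By Tonelli this equals half of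
     int K (T |x - t|) dF(x),   K s := int_{|y| >= s} rho(y) dy,
   and K (T u) <= K (delta u) since T >= delta.  With
   A s := int_{|y| >= s} |y| rho(y) dy = 2 rho_{1,0}(s), the quotient A / K, a
   conditional mean of |y|, is smallest at s = 0, where it is c_{rho,1}.
   Hence K <= 2 c_{rho,1}^-1 rho_{1,0}, which is the asserted bound. *)
From HB Require Import structures.
Require Import Defs.
From mathcomp Require Import all_boot all_order all_algebra.
From mathcomp Require Import all_classical all_reals all_analysis.
From mathcomp Require Import measurable_realfun ring lra.

Set Implicit Arguments.
Unset Strict Implicit.
Unset Printing Implicit Defensive.
Import Order.TTheory GRing.Theory Num.Theory.
Import numFieldNormedType.Exports.

Local Open Scope classical_set_scope.
Local Open Scope ring_scope.

(** * Lebesgue measure under the reflections x |-> a (t - x) *)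

Section reflection.
Context {R : realType}.
Local Notation mu := (@lebesgue_measure R).

Let refl (a t : R) : R -> measurableTypeR R := fun x => a * (t - x).

Lemma measurable_affine_refl (a t : R) :
  measurable_fun setT (fun x : R => a * (t - x)).
Proof. by apply: measurable_funM => //; exact: measurable_funB. Qed.

(** By uniqueness of Lebesgue measure: the left side is a measure in A, and it has the right value
    on half-open intervals. The reflection moves the closed endpoint to the other side, which does
    not affect the length. *)
Lemma lebesgue_measure_refl (a t : R) (A : set R) : 0 < a -> measurable A ->
  (a%:E * mu ((fun x => a * (t - x))%R @^-1` A))%E = mu A.
Proof.
move=> a0 mA.
have mr : measurable_fun setT (refl a t) by exact: measurable_affine_refl.
pose P : {measure set _ -> \bar R} :=
  mscale (NngNum (ltW a0)) (pushforward mu (refl a t)).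
suff : mu A = P mr A by move=> ->.
apply: lebesgue_measure_unique => //= _ [[u v]] _ <-.
rewrite /mscale /pushforward/=.
have E : refl a t @^-1` `]u, v]%classic = `[t - v / a, t - u / a[%classic.
  apply/seteqP; split => x /=; rewrite !in_itv/= /refl => /andP[h1 h2]; apply/andP; split.
  - by rewrite lerBlDr -lerBlDl ler_pdivlMr// mulrC.
  - by rewrite ltrBrDr -ltrBrDl ltr_pdivrMr// mulrC.
  - by rewrite mulrC -ltr_pdivrMr// ltrBrDl -ltrBrDr.
  - by rewrite mulrC -ler_pdivlMr// lerBlDl -lerBlDr.
rewrite [X in (_ * mu X)%E]E !lebesgue_measure_itv/= !lte_fin ltrD2l ltrN2 ltr_pM2r ?invr_gt0//.
case: ifPn => _; last by rewrite mule0.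
by rewrite -!EFinB -EFinM; congr (_%:E); field; rewrite gt_eqF.
Qed.

Lemma ge0_integral_refl (a t : R) (f : R -> \bar R) : 0 < a ->
  measurable_fun setT f -> (forall x, 0 <= f x)%E ->
  (\int[mu]_x f x = a%:E * \int[mu]_x f (a * (t - x))%R)%E.
Proof.
move=> a0 mf f0.
have mr : measurable_fun setT (refl a t) by exact: measurable_affine_refl.
have := @ge0_integral_pushforward _ _ (measurableTypeR R)
  (measurableTypeR R) R (refl a t) mr mu setT f measurableT mf.
rewrite preimage_setT => <-; last by move=> x _; exact: f0.
rewrite -(@ge0_integral_mscale _ _ _ _ setT measurableT (NngNum (ltW a0)))//.
apply: eq_measure_integral => A mA _.
exact/esym/(lebesgue_measure_refl t a0).
Qed.

Lemma ge0_integralN (f : R -> \bar R) :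
  measurable_fun setT f -> (forall x, 0 <= f x)%E ->
  (\int[mu]_x f x = \int[mu]_x f (- x)%R)%E.
Proof.
move=> mf f0; rewrite (ge0_integral_refl 0 ltr01 mf f0) mul1e.
by under eq_integral do rewrite sub0r mul1r.
Qed.

End reflection.

(** * Stieltjes mass of intervals *)

Section stieltjes_itv.
Context {R : realType} (F : R -> R) (ndF : {homo F : x y / x <= y}).

Lemma stieltjes_ocitv (a b : R) : a <= b ->
  stieltjes ndF `]a, b] = (right_limit F b - right_limit F a)%:E.
Proof.
move=> ab; rewrite -(wlength_itv_bnd _ false false ab).
exact/measurable_mu_extE/is_ocitv.
Qed.

(** The closed interval carries the full jumps at [a] and [b]. It is the decreasing limit of the
    intervals from a - 1/(n+1) to b, whose mass is at least F b - F a because F (a - 1/(n+1) + 0) <=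
    F a and F b <= F (b + 0). *)
Lemma le_stieltjes_itv (a b : R) : a <= b ->
  ((F b - F a)%:E <= stieltjes ndF `[a, b])%E.
Proof.
move=> ab.
have -> : `[a, b]%classic = \bigcap_n `](a - n.+1%:R^-1)%R, b]%classic.
  apply/seteqP; split => x /=.
    rewrite in_itv/= => /andP[ax xb] n _ /=; rewrite in_itv/= xb andbT.
    by rewrite (lt_le_trans _ ax)// gtrBl invr_gt0.
  move=> h; have := h 0 I; rewrite /= !in_itv/= => /andP[_ ->]; rewrite andbT.
  apply/ler_addgt0Pr => e e0.
  near \oo => n.
  have /= := h n I; rewrite in_itv/= ltrBlDr => /andP[/ltW + _].
  move=> /le_trans; apply; rewrite lerD2l ltW//.
  near: n; exact: near_infty_natSinv_lt (PosNum e0).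
have /cvg_lim <- // : stieltjes ndF `](a - n.+1%:R^-1)%R, b]%classic @[n --> \oo] -->
    stieltjes ndF (\bigcap_n `](a - n.+1%:R^-1)%R, b]%classic).
  apply: nonincreasing_cvg_mu => //.
  - by rewrite [ltLHS]stieltjes_ocitv ?ltry// (le_trans _ ab)// gerBl invr_ge0.
  - exact: bigcapT_measurable.
  - move=> m n mn; apply/subsetPset => x /=; rewrite !in_itv/= => /andP[h ->].
    rewrite andbT (le_lt_trans _ h)// lerD2l lerN2 lef_pV2 ?posrE//.
    by rewrite ler_nat.
apply: lime_ge.
  apply: ereal_nonincreasing_is_cvgn => m n mn; apply: le_measure; rewrite ?inE//=.
  apply: subset_itvr; rewrite bnd_simp.
  by rewrite lerD2l lerN2 lef_pV2 ?posrE// ler_nat.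
apply: nearW => n; rewrite stieltjes_ocitv; last first.
  by rewrite (le_trans _ ab)// gerBl invr_ge0.
rewrite lee_fin lerB ?le_right_limit// ge_right_limit//.
by rewrite gtrBl invr_gt0.
Unshelve. all: by end_near. Qed.

End stieltjes_itv.

(** * Integrability of the first moment from the decay bound *)

Lemma continuous_onedsqr {R : realType} : continuous (fun x : R => 1 + x ^+ 2).
Proof. by move=> x; apply: cvgD; [exact: cvg_cst|exact: exprn_continuous]. Qed.

(** The dominating function is C [|x|] (1 + x^2)^(-m-1). It is even, and on the half-line it has an
    explicit antiderivative that vanishes at infinity because m > 0. *)
Lemma integrable_moment1 {R : realType} (f : R -> R) (m C : R) :
  measurable_fun setT f -> 0 < m ->
  (forall x, `|f x| <= C * (1 + x ^+ 2) `^ (- m - 1)) ->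
  lebesgue_measure.-integrable setT (fun x => (x * f x)%:E).
Proof.
move=> mf m0 fC.
pose q (x : R) := 1 + x ^+ 2.
have q0 x : 0 < q x by rewrite ltr_pwDl// sqr_ge0.
pose g (x : R) := `|x| * q x `^ (- m - 1).
have cq p : continuous (fun x : R => q x `^ p).
  move=> x; apply: (@continuous_comp _ _ _ q (@powR R ^~ p)).
    exact: continuous_onedsqr.
  have /derivable1_diffP/differentiable_continuous : derivable (@powR R ^~ p) (q x) 1.
    by apply: derivable_powR; rewrite in_itv/= q0.
  exact.
have cg : continuous g.
  by move=> x; apply: cvgM; [exact: norm_continuous|exact: cq].
have g0 x : 0 <= g x by rewrite mulr_ge0// powR_ge0.
have intg : (\int[lebesgue_measure]_x (g x)%:E < +oo)%E.
  rewrite ge0_symfun_integralT//; last first.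
    by move=> x; rewrite /g /q /= normrN sqrrN.
  have -> : (\int[lebesgue_measure]_(x in [set x | 0 <= x]%R) (g x)%:E =
      \int[lebesgue_measure]_(x in `[0%R, +oo[) (x * q x `^ (- m - 1))%:E)%E.
    rewrite -set_itvcy; apply: eq_integral => x.
    by rewrite inE/= in_itv/= andbT => x0; rewrite /g ger0_norm.
  have dF (x : R) : is_derive x 1 (fun x => - (2 * m)^-1 * q x `^ (- m))
      (x * q x `^ (- m - 1)).
    have dq : is_derive x 1 q (2 * x).
      rewrite /q; apply: is_derive_eq.
      by rewrite add0r /GRing.scale/= mulr1; ring.
    have dp := is_derive1_powR (- m) (q0 x).
    have := @is_derive1_comp _ _ q _ _ _ dp dq.
    move=> dc; apply: is_derive_eq; rewrite /GRing.scale/=.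
    by field; rewrite gt_eqF.
  rewrite (@ge0_continuous_FTC2y _ _ (fun x => - (2 * m)^-1 * q x `^ (- m)) 0 0).
  - by rewrite -EFinB -EFinM ltry.
  - by move=> x x0; rewrite mulr_ge0// powR_ge0.
  - apply: continuous_subspaceT => x; apply: cvgM; [exact: cvg_id|exact: cq].
  - rewrite -[X in _ --> X](mulr0 (- (2 * m)^-1)); apply: cvgM; first exact: cvg_cst.
    (* The bound q(x)^(-m) <= e amounts to e^(-1/m) <= q(x). This holds once x >= 1 and x >=
       e^(-1/m), since x <= 1 + x^2. *)
    apply/cvgrPdist_le => e e0; near=> x.
    rewrite sub0r normrN ger0_norm ?powR_ge0// powRN.
    rewrite invf_ple ?posrE ?powR_gt0//.
    have -> : e^-1 = (e^-1 `^ m^-1) `^ m.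
      by rewrite -powRrM mulVf ?gt_eqF// powRr1// invr_ge0 ltW.
    apply: ge0_ler_powR; rewrite ?nnegrE ?powR_ge0 ?(ltW (q0 _)) ?(ltW m0)//.
    have x1 : 1 <= x by near: x; exact: nbhs_pinfty_ge.
    apply: (@le_trans _ _ x); first by near: x; exact: nbhs_pinfty_ge.
    by rewrite /q expr2; nra.
  - by move=> x _; apply: ex_derive.
  - apply: cvg_at_right_filter; apply: cvgM; [exact: cvg_cst|exact: cq].
  - by move=> x _; rewrite derive1E; exact: derive_val.
have mg : measurable_fun setT g by exact: continuous_measurable_fun.
apply: (@le_integrable _ (measurableTypeR R) R lebesgue_measure setT measurableT _
  (EFin \o (fun x : R => C * g x))) => //.
- by apply/measurable_EFinP/measurable_funM.
- move=> x _ /=; rewrite lee_fin normrM [leRHS]ger0_norm.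
    by rewrite /g mulrCA ler_wpM2l.
  rewrite mulr_ge0//.
  (* C >= 0 is read off the decay bound at 0, where the weight is 1. *)
  have := le_trans (normr_ge0 _) (fC 0).
  by rewrite expr0n/= addr0 powR1 mulr1.
- have -> : EFin \o (fun x => C * g x) = (fun x => C%:E * (g x)%:E)%E by [].
  apply: integrableZl => //.
  apply/integrableP; split; first exact/measurable_EFinP.
  by under eq_integral do rewrite gee0_abs ?lee_fin//.
Unshelve. all: by end_near. Qed.

(** * Tail integrals and their relation to [rho10] *)

Section tail_integral.
Context {R : realType}.
Local Notation mu := (@lebesgue_measure R).
Implicit Types (f g h : R -> R) (s : R).

Lemma measurable_le_norm s : measurable [set y : R | s <= `|y|].
Proof.
rewrite (_ : [set y : R | s <= `|y|] = ~` [set y : R | `|y| < s]).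
  rewrite -[X in ~` X]setTI; apply: measurableC.
  rewrite (_ : [set _ | _] = (@Num.norm R R) @^-1` `]-oo, s[%classic).
    by apply: normr_measurable.
  by apply/seteqP; split => y; rewrite /= in_itv/=.
by apply/seteqP; split => y /=; rewrite leNgt => /negP.
Qed.

(** For f = rho this is K, and for f = [|y| * rho y] it is A. Values lie in the extended reals, so
    that Tonelli and monotonicity apply before finiteness is known. *)
Definition tail_integral f s : \bar R :=
  (\int[mu]_(y in [set y : R | (s <= `|y|)%R]) (f y)%:E)%E.

Lemma tail_ge0 f s : (forall y, 0 <= f y) -> (0 <= tail_integral f s)%E.
Proof. by move=> f0; apply: integral_ge0 => y _; rewrite lee_fin. Qed.

Lemma tail_le f s s' : measurable_fun setT f -> (forall y, 0 <= f y) -> s <= s' ->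
  (tail_integral f s' <= tail_integral f s)%E.
Proof.
move=> mf f0 ss'; apply: ge0_subset_integral => //.
- exact: measurable_le_norm.
- exact: measurable_le_norm.
- by apply/measurable_EFinP; exact: measurable_funTS.
- by move=> y _; rewrite lee_fin.
- by move=> y /=; exact: le_trans.
Qed.

(* For s >= c the integrand dominates; for s < c one compares the integrals over
   the complement {|y| < s} instead, the two total integrals being equal. *)
Lemma mean_mul_tail_le f s (c : R) : measurable_fun setT f -> (forall y, 0 <= f y) ->
  (\int[mu]_y (f y)%:E = 1)%E ->
  (\int[mu]_y (`|y| * f y)%:E = c%:E)%E ->
  (c%:E * tail_integral f s <= tail_integral (fun y => `|y| * f y)%R s)%E.
Proof.
move=> mf f0 f1 fc.
have mA := measurable_le_norm s.
have mB := measurableC mA.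
have mnf : measurable_fun setT (fun y : R => `|y| * f y).
  by apply: measurable_funM => //; exact: normr_measurable.
have nf0 y : 0 <= `|y| * f y by exact: mulr_ge0.
have c0 : 0 <= c by rewrite -lee_fin -fc integral_ge0// => y _; rewrite lee_fin.
have mfE D : @measurable_fun _ _ (measurableTypeR R) _ D (fun y => (f y)%:E).
  by apply/measurable_EFinP; exact: measurable_funTS.
have mnfE D : @measurable_fun _ _ (measurableTypeR R) _ D (fun y : R => (`|y| * f y)%:E).
  by apply/measurable_EFinP; exact: measurable_funTS.
have [cs|sc] := leP c s.
  rewrite /tail_integral -ge0_integralZl//; last by move=> y _; rewrite lee_fin.
  apply: ge0_le_integral => //.
  - by move=> y _; rewrite lee_fin mulr_ge0.
  - exact: measurable_funeM.
  - by move=> y /= sy; rewrite lee_fin ler_wpM2r// (le_trans cs).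
pose D := ~` [set y : R | s <= `|y|].
have split g : measurable_fun setT g -> (forall y, 0 <= g y) ->
    (\int[mu]_y (g y)%:E = tail_integral g s + \int[mu]_(y in D) (g y)%:E)%E.
  move=> mg g0; rewrite /tail_integral -ge0_integral_setU//; last 3 first.
  - by apply/measurable_EFinP; exact: measurable_funTS.
  - by move=> y _; rewrite lee_fin.
  - by apply/disj_setPS => y [].
  by rewrite setUv.
(* This mass is at most 1; being finite, c times it can be added to both sides and cancelled in the
   extended reals. *)
have Dfin : (\int[mu]_(y in D) (f y)%:E)%E \is a fin_num.
  rewrite ge0_fin_numE; last by apply: integral_ge0 => y _; rewrite lee_fin.
  apply: (@le_lt_trans _ _ 1%E); last exact: ltry.
  by rewrite -f1 ge0_subset_integral// => y _; rewrite lee_fin.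
rewrite -(@leeD2rE _ (c%:E * \int[mu]_(y in D) (f y)%:E)%E) ?fin_numM//.
rewrite -ge0_muleDr ?tail_ge0//; last first.
  by apply: integral_ge0 => y _; rewrite lee_fin.
rewrite -split// f1 mule1 -[leLHS]fc split//; apply: leeD2l.
rewrite -ge0_integralZl//; last by move=> y _; rewrite lee_fin.
apply: ge0_le_integral => //.
- by move=> y _; rewrite lee_fin.
- exact: measurable_funeM.
- move=> y /= /negP; rewrite -ltNge => ys; rewrite lee_fin ler_wpM2r//.
  exact/ltW/(lt_trans ys).
Qed.

Lemma RintegralN f : measurable_fun setT f ->
  \int[mu]_x f x = \int[mu]_x f (- x).
Proof.
move=> mf; rewrite /Rintegral; congr fine.
have mfE : measurable_fun setT (EFin \o f) by exact/measurable_EFinP.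
rewrite integralE [RHS]integralE; congr (_ - _)%E.
  rewrite ge0_integralN; [|exact (measurable_funepos mfE)|by []].
  by apply: eq_integral => x _; rewrite !funeposE.
rewrite ge0_integralN; [|exact (measurable_funeneg mfE)|by []].
  by apply: eq_integral => x _; rewrite !funenegE.
Qed.

(** The integral over A is averaged with its image under x |-> - x, where oddness of f produces the
    minus sign. This reduces [rho10E] to a pointwise comparison of integrands. *)
Lemma Rintegral_odd_indic (P : pred R) f (A := [set x | P x]) : measurable A ->
  mu.-integrable setT (EFin \o f) -> (forall x, f (- x) = - f x) ->
  2 * \int[mu]_(x in A) f x = \int[mu]_x (f x * ((P x)%:R - (P (- x))%:R)).
Proof.
move=> mA intf oddf.
have mf : measurable_fun setT f.
  by move/integrableP : (intf) => [mfE _]; exact/measurable_EFinP.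
have mP : measurable_fun setT (fun x => (P x)%:R : R).
  rewrite (_ : (fun _ => _) = \1_A); first exact: measurable_indic.
  by apply/funext => x; rewrite indicE /A mem_setE.
have intfP : mu.-integrable setT (EFin \o (fun x => f x * (P x)%:R)).
  apply: (@le_integrable _ (measurableTypeR R) R mu setT measurableT _ (EFin \o f)) => //.
    by apply/measurable_EFinP; exact: measurable_funM.
  move=> x _ /=; rewrite lee_fin normrM ler_piMr//.
  by case: (P x); rewrite ?normr1 ?normr0.
have mPN : measurable_fun setT (fun x : R => (P (- x))%:R : R).
  by apply: (measurableT_comp mP); exact: oppr_measurable.
have intfPN : mu.-integrable setT (EFin \o (fun x => f x * (P (- x))%:R)).
  apply: (@le_integrable _ (measurableTypeR R) R mu setT measurableT _ (EFin \o f)) => //.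
    by apply/measurable_EFinP; exact: measurable_funM.
  move=> x _ /=; rewrite lee_fin normrM ler_piMr//.
  by case: (P (- x)); rewrite ?normr1 ?normr0.
have AE : \int[mu]_(x in A) f x = \int[mu]_x (f x * (P x)%:R).
  rewrite Rintegral_mkcond; apply: eq_Rintegral => x _.
  rewrite patchE; have [Px|/negP Px] := boolP (P x).
    by rewrite mem_set// mulr1.
  by rewrite memNset// mulr0.
under [RHS]eq_Rintegral do rewrite mulrBr.
rewrite RintegralB// AE mulr_natl mulr2n; congr (_ + _).
rewrite RintegralN; last exact: measurable_funM.
under eq_Rintegral do rewrite oddf mulNr -mulN1r.
by rewrite RintegralZl// mulN1r.
Qed.

(** Since x rho(x) is odd, its integral over [s, +oo[ is half of the two-sided tail of
    [|x| * rho x]. For s < 0 the part between s and - s cancels, hence the absolute value of s. *)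
Lemma rho10E (rho : R -> R) s :
  mu.-integrable setT (fun x => (x * rho x)%:E) -> (forall x, rho (- x) = rho x) ->
  rho10 rho s = 2^-1 * fine (tail_integral (fun y => `|y| * rho y) `|s|).
Proof.
move=> intr evenr.
suff -> : fine (tail_integral (fun y => `|y| * rho y) `|s|) = 2 * rho10 rho s.
  by rewrite mulrA mulVf ?mul1r// pnatr_eq0.
have oddr x : - x * rho (- x) = - (x * rho x) by rewrite evenr mulNr.
have -> : fine (tail_integral (fun y => `|y| * rho y) `|s|) =
    \int[mu]_(y in [set y : R | `|s| <= `|y|]) (`|y| * rho y) by [].
rewrite Rintegral_mkcond.
have patchE x : ((fun y => `|y| * rho y) \_ [set y : R | `|s| <= `|y|]) x =
    if `|s| <= `|x| then `|x| * rho x else 0.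
  rewrite patchE; case: ifPn => [/[!inE]/= -> //|].
  by rewrite notin_setE/= => /negP/negPf ->.
have [s0|s0] := leP 0 s.
  rewrite /rho10 set_itvcy (@Rintegral_odd_indic (fun x => s <= x))//; last first.
    by rewrite -set_itvcy.
  apply: eq_Rintegral => /= x _; rewrite patchE (ger0_norm s0); move: (x : R) => {}x.
  have [x0|x0] := leP 0 x.
    rewrite ger0_norm//.
    have [h1|h1] := leP s x; have [h2|h2] := leP s (- x) => /=.
    - have -> : x = 0 by lra.
      by rewrite !mul0r.
    - by rewrite subr0 mulr1.
    - by lra.
    - by rewrite subr0 mulr0.
  rewrite ltr0_norm//.
  have [h1|h1] := leP s x; have [h2|h2] := leP s (- x) => /=; [lra|lra| |].
    by rewrite sub0r mulrN1 mulNr.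
  by rewrite subr0 mulr0.
(* For s < 0 the half-line is opened at s: then at [|x| = |s|] exactly one of the two indicators
   equals 1, which agrees pointwise with the non-strict inequality defining the tail. *)
rewrite /rho10 -Rintegral_itv_obnd_cbnd; last first.
  exact: integrableS intr.
rewrite set_itvoy (@Rintegral_odd_indic (fun x => s < x))//; last first.
  by rewrite -set_itvoy.
apply: eq_Rintegral => /= x _; rewrite patchE (ltr0_norm s0); move: (x : R) => {}x.
have [x0|x0] := leP 0 x.
  have -> : (s < x) by exact: lt_le_trans x0.
  rewrite ltrNr ger0_norm//; case: leP => _; rewrite ?subr0 ?subrr ?mulr1 ?mulr0//.
have -> : (s < - x) by lra.
by rewrite ltr0_norm// lerN2; case: leP => _; rewrite ?sub0r ?subrr ?mulrN1 ?mulr0 ?mulNr.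
Qed.

End tail_integral.

(** * Tonelli exchange between masses of centred intervals and tails *)

Section tonelli.
Context {R : realType}.
Local Notation mu := (@lebesgue_measure R).

Let measurable_cone (a t : R) :
  measurable [set z : measurableTypeR R * measurableTypeR R | a * `|z.2 - t| <= `|z.1|].
Proof.
have m1 : measurable_fun setT
    (fun z : measurableTypeR R * measurableTypeR R => a * `|z.2 - t|).
  apply: measurable_funM => //; apply: (measurableT_comp (@normr_measurable R setT)).
  by apply: measurable_funB => //; exact: measurable_snd.
have m2 : measurable_fun setT
    (fun z : measurableTypeR R * measurableTypeR R => `|z.1|).
  by apply: (measurableT_comp (@normr_measurable R setT)); exact: measurable_fst.
by have := measurable_fun_ler m1 m2 measurableT (Y := [set true]) I; rewrite setTI.
Qed.

Variables (nu : {sigma_finite_measure set (measurableTypeR R) -> \bar R}).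
Variables (f : R -> R) (a t : R).
Hypotheses (mf : measurable_fun setT f) (f0 : forall y, 0 <= f y).

(** The density f(y) on the cone [a * |x - t| <= |y|], in the pair (y, x). Its slice at fixed x is a
    tail of f; for a > 0 its slice at fixed y is the closed interval of radius [|y| / a] about t. *)
Let h (z : measurableTypeR R * measurableTypeR R) : \bar R :=
  (f z.1 * \1_[set z : R * R | a * `|z.2 - t| <= `|z.1|] z)%:E.

Let mh : measurable_fun setT h.
Proof.
apply/measurable_EFinP; apply: measurable_funM.
  by apply: (measurableT_comp mf); exact: measurable_fst.
by apply: measurable_indic; exact: (measurable_cone a t).
Qed.

Let h0 z : (0 <= h z)%E.
Proof. by rewrite lee_fin mulr_ge0. Qed.

Let hG x : (\int[mu]_y h (y, x) = tail_integral f (a * `|x - t|)%R)%E.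
Proof.
rewrite /tail_integral [RHS]integral_mkcond; apply: eq_integral => y _.
rewrite patchE /h /= indicE; case: ifPn.
  by rewrite inE/= => yx; rewrite mem_set//= mulr1.
by rewrite notin_setE/= => yx; rewrite memNset//= mulr0.
Qed.

Let hF y : (\int[nu]_x h (y, x) =
  (f y)%:E * nu [set x : R | (a * `|x - t| <= `|y|)%R])%E.
Proof.
have mE : measurable [set x : R | (a * `|x - t| <= `|y|)%R].
  have m1 : measurable_fun setT (fun x : measurableTypeR R => a * `|x - t|).
    apply: measurable_funM => //; apply: (measurableT_comp (@normr_measurable R setT)).
    exact: measurable_funB.
  have m2 : measurable_fun setT (fun _ : measurableTypeR R => `|y| : R) by [].
  by have := measurable_fun_ler m1 m2 measurableT (Y := [set true]) I; rewrite setTI.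
transitivity (\int[nu]_x ((f y)%:E *
    (\1_[set x : R | (a * `|x - t| <= `|y|)%R] x)%:E))%E.
  by apply: eq_integral => x _; rewrite /h EFinM !indicE.
rewrite ge0_integralZl//.
- by rewrite integral_indic// setIT.
- by apply/measurable_EFinP/measurable_indic.
- by rewrite lee_fin.
Qed.

Lemma ge0_tonelli_tail :
  (\int[mu]_y ((f y)%:E * nu [set x : R | (a * `|x - t| <= `|y|)%R]) =
   \int[nu]_x tail_integral f (a * `|x - t|)%R)%E.
Proof.
under eq_integral do rewrite -hF.
by rewrite fubini_tonelli//; apply: eq_integral => x _; exact: hG.
Qed.

Lemma measurable_mul_measure_norm : @measurable_fun _ _ (measurableTypeR R) _ setT
  (fun y => (f y)%:E * nu [set x : R | (a * `|x - t| <= `|y|)%R])%E.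
Proof.
have := measurable_fun_fubini_tonelli_F (m2 := nu) _ mh h0.
by apply: eq_measurable_fun => y _; exact: hF.
Qed.

Lemma measurable_tail_norm : measurable_fun setT (fun x : R => tail_integral f (a * `|x - t|)).
Proof.
have := measurable_fun_fubini_tonelli_G (m1 := mu) _ mh h0.
by apply: eq_measurable_fun => x _; exact: hG.
Qed.

End tonelli.

(** * Truncated integrals and their limits *)

(** Dominated convergence with majorant [|g|], applied along every sequence tending to +oo. *)
Lemma cvg_integral_itvNr {R : realType} (g : R -> R) :
  lebesgue_measure.-integrable setT (EFin \o g) ->
  (\int[lebesgue_measure]_(x in `[(- r)%R, r]) (g x)%:E)%E @[r --> +oo] -->
  (\int[lebesgue_measure]_x (g x)%:E)%E.
Proof.
move=> intg; apply/cvge_pinftyP => u uy.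
have mg : measurable_fun setT (EFin \o g) by case/integrableP : (intg).
under eq_fun do rewrite integral_mkcond.
apply: (@dominated_cvg _ (measurableTypeR R) R lebesgue_measure setT measurableT
  _ _ (fun x => `|(g x)%:E|)%E) => //.
- move=> n; apply/(measurable_restrictT (EFin \o g)) => //.
  exact: measurable_funTS.
- move=> x _; apply: cvg_near_cst.
  have xu : \forall n \near \oo, `|x : R| <= u n by exact/(cvgryPge _).1.
  apply: filterS xu => n xn; rewrite patchE mem_set//= in_itv/=.
  by rewrite -ler_norml.
- exact: integrable_abse.
- move=> n x _; rewrite patchE; case: ifPn => // _.
  by rewrite abse0.
Qed.

(** For a nonnegative integrand the truncations are nondecreasing in r, so the limit exists,
    possibly infinite, and may be computed along the integers by monotone convergence. *)
Lemma cvg_integral_itvoNr {R : realType}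
  (nu : {measure set (measurableTypeR R) -> \bar R}) (f : R -> R) :
  measurable_fun setT f -> (forall x, 0 <= f x) ->
  (\int[nu]_(x in `](- r)%R, r[) (f x)%:E)%E @[r --> +oo] -->
  (\int[nu]_x (f x)%:E)%E.
Proof.
move=> mf f0.
have mfE D : @measurable_fun _ _ (measurableTypeR R) _ D (fun x => (f x)%:E).
  by apply/measurable_EFinP; exact: measurable_funTS.
pose I r := (\int[nu]_(x in `](- r)%R, r[) (f x)%:E)%E.
have ndI : {homo I : r s / (r <= s)%R >-> (r <= s)%E}.
  move=> r s rs; apply: ge0_subset_integral => //.
    by move=> x _; rewrite lee_fin.
  by apply: subset_itv; rewrite bnd_simp// lerN2.
suff <- : lim (I r @[r --> +oo]) = (\int[nu]_x (f x)%:E)%E.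
  exact: nondecreasing_is_cvge.
apply/esym.
have /cvge_pinftyP/(_ _ (@cvgr_idn R))/cvg_lim <- // := nondecreasing_is_cvge ndI.
apply/esym/cvg_lim => //.
rewrite [X in _ --> X](_ : _ =
    (\int[nu]_(x in \bigcup_n `](- n%:R)%R, n%:R[%classic) (f x)%:E)%E).
  apply: ge0_nondecreasing_set_cvg_integral => //.
  - move=> m n mn; apply/subsetPset/subset_itv; rewrite bnd_simp ?lerN2 ler_nat//.
  - by move=> n x _; rewrite lee_fin.
congr integral; apply/esym; rewrite -subTset => x _.
exists (Num.truncn `|x|).+1 => //=; rewrite in_itv/= -ltr_norml.
exact: truncnS_gt.
Qed.

(** * Weighted oscillation of F bounded by a Stieltjes integral *)

Section oscillation.
Context {R : realType} (F : R -> R) (ndF : {homo F : x y / x <= y}).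
Local Notation mu := (@lebesgue_measure R).

(* Averaging over the reflection x |-> 2t - x turns the two one-sided
   increments of F into the mass of a closed interval centred at t, so that the
   value of F at its jump at t is irrelevant. *)
Lemma oscillation_le (rho : R -> R) (T t : R) : 0 < T ->
  measurable_fun setT rho -> (forall x, 0 <= rho x) ->
  (forall x, rho (- x) = rho x) ->
  (2%:E * \int[mu]_x (rescale T rho (t - x) * `|F x - F t|)%:E <=
   \int[stieltjes ndF]_x tail_integral rho (T * `|x - t|)%R)%E.
Proof.
move=> T0 mrho rho0 evenrho.
have mF : measurable_fun setT F by apply: nondecreasing_measurable.
have maff (k : R) : measurable_fun setT (fun y : R => t + k * y).
  by apply: measurable_funD => //; exact: measurable_funM.
(* [k] will be -1/T, as x = t - y/T inverts y = T (t - x), and then 1/T for the reflected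
   integral. *)
pose q (k y : R) := rho y * `|F (t + k * y) - F t|.
have mq k : measurable_fun setT (q k).
  apply: measurable_funM => //; apply: (measurableT_comp (@normr_measurable R setT)).
  by apply: measurable_funB => //; exact: (measurableT_comp mF (maff k)).
have q0 k y : 0 <= q k y by rewrite mulr_ge0.
have mqE k : @measurable_fun _ _ (measurableTypeR R) _ setT (fun y => (q k y)%:E).
  by apply/measurable_EFinP; exact: mq.
have E1 : (\int[mu]_x (rescale T rho (t - x) * `|F x - F t|)%:E =
    \int[mu]_y (q (- T^-1) y)%:E)%E.
  rewrite (ge0_integral_refl t T0 (mqE _))//; last by move=> y; rewrite lee_fin.
  rewrite -ge0_integralZl//; last 3 first.
  - apply/measurable_EFinP.
    exact: (measurableT_comp (mq _) (measurable_affine_refl T t)).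
  - by move=> y _; rewrite lee_fin.
  - by rewrite lee_fin ltW.
  apply: eq_integral => x _; rewrite -EFinM /rescale /q -mulrA; congr (T * (_ * `|F _ - _|))%:E.
  by field; rewrite gt_eqF.
have E2 : (\int[mu]_y (q (- T^-1) y)%:E = \int[mu]_y (q T^-1 y)%:E)%E.
  rewrite ge0_integralN; [|exact (mqE _)|by move=> y; rewrite lee_fin].
  by apply: eq_integral => y _; rewrite /q evenrho mulrNN.
rewrite E1 mule_natl mule2n {2}E2 -ge0_integralD//; last 2 first.
- by move=> y _; rewrite lee_fin.
- by move=> y _; rewrite lee_fin.
rewrite -ge0_tonelli_tail//.
apply: ge0_le_integral => //.
- by move=> y _; rewrite adde_ge0// lee_fin.
- by apply: emeasurable_funD.
- exact: measurable_mul_measure_norm.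
move=> y _; rewrite -EFinD /q -mulrDr EFinM; apply: lee_wpmul2l; first by rewrite lee_fin.
have Ty0 : 0 <= `|y| / T by rewrite divr_ge0// ltW.
have ab : t - `|y| / T <= t + `|y| / T by lra.
have -> : [set x : R | T * `|x - t| <= `|y|] = `[t - `|y| / T, t + `|y| / T]%classic.
  apply/seteqP; split => x /=; rewrite in_itv/= -ler_distl ler_pdivlMr// mulrC//.
apply: (le_trans _ (le_stieltjes_itv ndF ab)); rewrite lee_fin.
have h1 : F (t - `|y| / T) <= F t by apply: ndF; lra.
have h2 : F t <= F (t + `|y| / T) by apply: ndF; lra.
have [y0|y0] := leP 0 y.
  rewrite !(ger0_norm y0) in h1 h2 *.
  rewrite !mulNr -!(mulrC y) ler0_norm ?subr_le0// ger0_norm ?subr_ge0//; lra.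
rewrite !(ltr0_norm y0) in h1 h2 *.
rewrite !mulNr -!(mulrC y).
rewrite !mulNr opprK in h1 h2 *.
rewrite ger0_norm ?subr_ge0// ler0_norm ?subr_le0//; lra.
Qed.

End oscillation.

(** * The constant c_{rho,1} and weighted means *)

(** If the moment vanished, x rho(x) would be 0 almost everywhere, hence also rho, as {0} is a null
    set; this contradicts total mass 1. *)
Lemma abs_moment1_gt0 {R : realType} (rho : R -> R) :
  measurable_fun setT rho -> (forall x, 0 <= rho x) ->
  (\int[lebesgue_measure]_x (rho x)%:E = 1)%E ->
  lebesgue_measure.-integrable setT (fun x => (x * rho x)%:E) ->
  (\int[lebesgue_measure]_x (`|x| * rho x)%:E = (abs_moment1 rho)%:E)%E /\
  0 < abs_moment1 rho.
Proof.
move=> mrho rho0 rho1 intrho.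
have E0 : (\int[lebesgue_measure]_x `|(x * rho x)%:E| =
    \int[lebesgue_measure]_x (`|x| * rho x)%:E)%E.
  by apply: eq_integral => x _ /=; rewrite normrM (ger0_norm (rho0 x)).
have E : (\int[lebesgue_measure]_x (`|x| * rho x)%:E = (abs_moment1 rho)%:E)%E.
  rewrite fineK// ge0_fin_numE; last first.
    by apply: integral_ge0 => x _; rewrite lee_fin mulr_ge0.
  by rewrite -E0; case/integrableP : intrho.
split => //; rewrite lt_neqAle Rintegral_ge0 ?andbT; last first.
  by move=> x _; rewrite mulr_ge0.
apply/negP => /eqP m0; move: E; rewrite -m0 -E0 => E.
have mi : measurable_fun setT (fun x : measurableTypeR R => (x * rho x)%:E).
  by case/integrableP : intrho.
have ae0 := (ae_eq_integral_abs (@lebesgue_measure R) measurableT mi).1 E.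
suff : (\int[lebesgue_measure]_x (rho x)%:E = 0)%E.
  by rewrite rho1 => /eqP; rewrite onee_eq0.
rewrite (_ : 0%E = \int[@lebesgue_measure R]_x (cst 0 x))%E; last by rewrite integral0.
apply: ae_eq_integral => //.
  exact/measurable_EFinP.
have ae1 : {ae @lebesgue_measure R, forall x : R, x != 0}.
  exists [set 0]; split => //; first exact: lebesgue_measure_set1.
  by move=> x /= /negP; rewrite negbK => /eqP.
move: ae0 ae1; apply: filterS2 => x /= /(_ I)[xrho] x0 _.
by move/eqP : xrho; rewrite mulf_eq0 (negPf x0)/= => /eqP ->.
Qed.

(** With g a probability density, g h = l g - g (l - h) is a difference of integrable functions, and
    l is the integral of l g. For h = F and l = F t this derives both the existence of the
    convolution and its error bound from the weighted oscillation. *)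
Lemma abse_weighted_mean_sub_le {R : realType} d (X : measurableType d)
    (mu : {measure set X -> \bar R}) (g h : X -> R) (l : R) :
  measurable_fun setT g -> measurable_fun setT h -> (forall x, 0 <= g x) ->
  (\int[mu]_x (g x)%:E = 1)%E ->
  (\int[mu]_x (g x * `|h x - l|)%:E < +oo)%E ->
  mu.-integrable setT (fun x => (g x * h x)%:E) /\
  (`|l%:E - \int[mu]_x (g x * h x)%:E| <= \int[mu]_x (g x * `|h x - l|)%:E)%E.
Proof.
move=> mg mh g0 g1 fin.
have intg : mu.-integrable setT (EFin \o g).
  apply/integrableP; split; first exact/measurable_EFinP.
  by under eq_integral do rewrite /= ger0_norm//; rewrite g1 ltry.
have absE x : `|(g x * (l - h x))%:E|%E = (g x * `|h x - l|)%:E.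
  by rewrite /= normrM ger0_norm// distrC.
have intd : mu.-integrable setT (fun x => (g x * (l - h x))%:E).
  apply/integrableP; split.
    by apply/measurable_EFinP; apply: measurable_funM => //; exact: measurable_funB.
  by under eq_integral do rewrite absE.
have intl : mu.-integrable setT (fun x => (l%:E * (g x)%:E)%E) by exact: integrableZl.
have intgh : mu.-integrable setT (fun x => (g x * h x)%:E).
  apply: eq_integrable (integrableB measurableT intl intd) => //= x _.
  by rewrite -EFinM -EFinB; congr EFin; ring.
split=> //.
have -> : (l%:E - \int[mu]_x (g x * h x)%:E = \int[mu]_x (g x * (l - h x))%:E)%E.
  rewrite -[X in (X - _)%E]mule1 -g1 -integralZl// -integralB//.
  by apply: eq_integral => x _; rewrite -EFinM -EFinB; congr EFin; ring.
apply: (le_trans (le_abse_integral mu measurableT (measurable_int mu intd))).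
by under eq_integral do rewrite absE.
Qed.

(** * Comparison of tails with rho_{1,0} and the oscillation bound *)

Section tail_rho10.
Context {R : realType} (rho : R -> R).
Hypotheses (mrho : measurable_fun setT rho) (rho0 : forall x, 0 <= rho x).
Hypotheses (rho_even : forall x, rho (- x) = rho x).
Hypothesis rho1 : (\int[lebesgue_measure]_x (rho x)%:E = 1)%E.
Hypothesis intrho : lebesgue_measure.-integrable setT (fun x => (x * rho x)%:E).

Let mnrho : measurable_fun setT (fun y : R => `|y| * rho y).
Proof. by apply: measurable_funM => //; exact: normr_measurable. Qed.

Let nrho0 (y : R) : 0 <= `|y| * rho y. Proof. exact: mulr_ge0. Qed.

Lemma EFin_rho10 (s : R) :
  (rho10 rho s)%:E = ((2^-1)%:E * tail_integral (fun y => `|y| * rho y)%R `|s|%R)%E.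
Proof.
have [momE _] := abs_moment1_gt0 mrho rho0 rho1 intrho.
rewrite rho10E// EFinM fineK// ge0_fin_numE; last exact: tail_ge0.
apply: le_lt_trans (ltry (abs_moment1 rho)).
rewrite -momE; apply: ge0_subset_integral => //.
- exact: measurable_le_norm.
- exact/measurable_EFinP.
- by move=> y _; rewrite lee_fin.
Qed.

Lemma rho10_ge0 (s : R) : 0 <= rho10 rho s.
Proof. by rewrite -lee_fin EFin_rho10 mule_ge0 ?lee_fin ?tail_ge0. Qed.

Lemma measurable_rescale_rho10 (a t : R) : 0 < a ->
  measurable_fun setT (fun x : R => rescale a (rho10 rho) (t - x)).
Proof.
move=> a0; apply: measurable_funM => //; apply/measurable_EFinP.
(* Measurability is inherited from the tail, which is a marginal of the Tonelli kernel. *)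
rewrite (_ : EFin \o _ = (fun x => (2^-1)%:E *
    tail_integral (fun y => `|y| * rho y)%R (a * `|x - t|)%R)%E).
  by apply: measurable_funeM; exact: measurable_tail_norm.
by apply/funext => x /=; rewrite EFin_rho10 normrM (gtr0_norm a0) distrC.
Qed.

Lemma tail_le_rho10 (a b u : R) : 0 < a -> a <= b ->
  (tail_integral rho (b * `|u|)%R <= (2 * (abs_moment1 rho)^-1 * rho10 rho (a * u))%:E)%E.
Proof.
move=> a0 ab; have [momE c0] := abs_moment1_gt0 mrho rho0 rho1 intrho.
apply: (@le_trans _ _ (tail_integral rho (a * `|u|)%R)).
  by apply: tail_le => //; exact: ler_wpM2r.
rewrite EFinM EFin_rho10 normrM (gtr0_norm a0) muleA -EFinM mulrAC divff//.
rewrite mul1r lee_pdivlMl//.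
exact: (mean_mul_tail_le _ mrho rho0 rho1 momE).
Qed.

Lemma weighted_oscillation_le (F : R -> R) (ndF : {homo F : x y / x <= y})
    (delta T t : R) : 0 < delta -> delta <= T ->
  (\int[lebesgue_measure]_x (rescale T rho (t - x) * `|F x - F t|)%:E <=
   ((abs_moment1 rho)^-1 * delta^-1)%:E *
     \int[stieltjes ndF]_x (rescale delta (rho10 rho) (t - x))%:E)%E.
Proof.
move=> d0 dT; have T0 := lt_le_trans d0 dT.
have [_ c0] := abs_moment1_gt0 mrho rho0 rho1 intrho.
have mphi := measurable_rescale_rho10 t d0.
have phi0 x : 0 <= rescale delta (rho10 rho) (t - x).
  by rewrite mulr_ge0 ?rho10_ge0// ltW.
(* The inequality is proved doubled, matching the factor 2 in [oscillation_le] and in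
   [tail_le_rho10]; the 2 is cancelled at the end. *)
have two_le : (2%:E * \int[lebesgue_measure]_x
      (rescale T rho (t - x) * `|F x - F t|)%:E <=
    2%:E * (((abs_moment1 rho)^-1 * delta^-1)%:E *
      \int[stieltjes ndF]_x (rescale delta (rho10 rho) (t - x))%:E))%E.
  apply: (le_trans (oscillation_le ndF t T0 mrho rho0 rho_even)).
  rewrite muleA -EFinM -ge0_integralZl; last 4 first.
  - by [].
  - exact/measurable_EFinP.
  - by move=> x _; rewrite lee_fin.
  - by rewrite lee_fin !mulr_ge0// invr_ge0 ltW.
  apply: ge0_le_integral => [//|x _|||x _].
  - exact: tail_ge0.
  - exact: measurable_tail_norm.
  - by apply: measurable_funeM; exact/measurable_EFinP.
  rewrite distrC; apply: (le_trans (tail_le_rho10 _ d0 dT)).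
  (* Both sides now agree: the factor delta inside [rescale] cancels [delta^-1]. *)
  rewrite -EFinM lee_fin /rescale le_eqVlt; apply/orP; left; apply/eqP.
  by field; rewrite !gt_eqF.
by move: two_le; rewrite lee_pmul2l// lte_fin.
Qed.

End tail_rho10.

(** * Existence of the convolution and the final estimate *)

Theorem theorem1p3 (R : realType) (F : R -> R)
    (ndF : {homo F : x y / x <= y})
    (midF : forall x, F x = 2^-1 * (right_limit F x + left_limit F x))
    (rho : R -> R) (rho_cont : continuous rho)
    (rho_decay : exists m C : R, 0 < m /\
       forall x, `|rho x| <= C * (1 + x ^+ 2) `^ (- m - 1))
    (rho_int : \int[lebesgue_measure]_x rho x = 1)
    (rho_even : forall x, rho (- x) = rho x)
    (rho_ge0 : forall x, 0 <= rho x)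
    (delta : R) (delta_gt0 : 0 < delta) (t : R)
    (vanish_pinfty :
       rescale delta (rho10 rho) (t - s) * F s @[s --> +oo] --> 0)
    (vanish_ninfty :
       rescale delta (rho10 rho) (t - s) * F s @[s --> -oo] --> 0)
    (conv_fin : (convolution_stieltjes (rescale delta (rho10 rho)) ndF t < +oo)%E)
    (T : R) (hT : delta <= T) :
  [/\ cvg (convolution_trunc (rescale T rho) F t r @[r --> +oo]),
      convolution (rescale T rho) F t \is a fin_num
    & (`|(F t)%:E - convolution (rescale T rho) F t| <=
       ((abs_moment1 rho)^-1 * delta^-1)%:E *
         convolution_stieltjes (rescale delta (rho10 rho)) ndF t)%E].
Proof.
have T0 : 0 < T by exact: lt_le_trans hT.
have mrho : measurable_fun setT rho by exact: continuous_measurable_fun.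
have rho1 : (\int[lebesgue_measure]_x (rho x)%:E = 1)%E.
  (* The real integral is [fine] of the extended one and [fine] sends infinite values to 0, so the
     value 1 forces the extended integral to be finite and equal to 1. *)
  move: rho_int; rewrite /Rintegral.
  case: (\int[lebesgue_measure]_x (rho x)%:E)%E => [r /= ->//|/= /eqP|/= /eqP];
    by rewrite eq_sym oner_eq0.
have [m [C [m0 rhoC]]] := rho_decay.
have intr := integrable_moment1 mrho m0 rhoC.
have [_ c0] := abs_moment1_gt0 mrho rho_ge0 rho1 intr.
have mphi := measurable_rescale_rho10 mrho rho_ge0 rho_even rho1 intr t delta_gt0.
have phi0 x : 0 <= rescale delta (rho10 rho) (t - x).
  by rewrite mulr_ge0 ?(ltW delta_gt0)// rho10_ge0.
have convE : convolution_stieltjes (rescale delta (rho10 rho)) ndF t =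
    (\int[stieltjes ndF]_x (rescale delta (rho10 rho) (t - x))%:E)%E.
  by apply/cvg_lim => //; exact (cvg_integral_itvoNr mphi phi0).
have osc := weighted_oscillation_le mrho rho_ge0 rho_even rho1 intr ndF t delta_gt0 hT.
rewrite -convE in osc.
have g0 x : 0 <= rescale T rho (t - x) by rewrite mulr_ge0// ltW.
have mg : measurable_fun setT (fun x : R => rescale T rho (t - x)).
  by apply: measurable_funM => //; exact: (measurableT_comp mrho (measurable_affine_refl T t)).
have mF : measurable_fun setT F by apply: nondecreasing_measurable.
have g1 : (\int[lebesgue_measure]_x (rescale T rho (t - x))%:E = 1)%E.
  have mrhoE : measurable_fun setT (EFin \o rho) by exact/measurable_EFinP.
  rewrite -rho1 [RHS](ge0_integral_refl t T0 mrhoE); last first.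
    by move=> y; rewrite lee_fin.
  rewrite -ge0_integralZl; last 4 first.
  - by [].
  - apply/measurable_EFinP.
    exact: (measurableT_comp mrho (measurable_affine_refl T t)).
  - by move=> y _; rewrite lee_fin.
  - by rewrite lee_fin ltW.
  by apply: eq_integral => x _; rewrite -EFinM.
(* Here [conv_fin] enters: it makes the weighted oscillation finite, hence rho_T(t - x) F(x)
   absolutely integrable in x, so that the symmetric truncations converge to its integral. *)
have osc_fin : (\int[lebesgue_measure]_x
    (rescale T rho (t - x) * `|F x - F t|)%:E < +oo)%E.
  apply: (le_lt_trans osc); apply: lte_mul_pinfty conv_fin => //.
  by rewrite lee_fin mulr_ge0// invr_ge0 ltW.
have [intgF meanF] := @abse_weighted_mean_sub_le _ _
  (measurableTypeR R) lebesgue_measure _ F (F t) mg mF g0 g1 osc_fin.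
have limE := cvg_integral_itvNr intgF.
have convolE : convolution (rescale T rho) F t =
    (\int[lebesgue_measure]_x (rescale T rho (t - x) * F x)%:E)%E.
  by apply/cvg_lim => //; exact: limE.
split; [by apply/cvg_ex; eexists; exact: limE| |].
  by rewrite convolE; exact: integrable_fin_num intgF.
by rewrite convolE; exact: le_trans osc.
Qed.
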